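(* (a) The map sending a non-empty finite metric space $X$ to its normalized degree-Rips bifiltration $\mathcal{DR}(X)$ is discontinuous with respect to the Gromov–Prohorov distance $d_{GPr}(\mu_X,\mu_Y)$ on uniform measures and the homotopy interleaving distance $d_{HI}$ on bifiltrations; that is, there exist non-empty finite metric spaces $Y$ and $Y^1,Y^2,\ldots$ with $d_{GPr}(\mu_{Y^n},\mu_Y)\to0$ as $n\to\infty$ but $d_{HI}(\mathcal{DR}(Y^n),\mathcal{DR}(Y))\not\to0$. (b) The map sending a non-empty finite subspace $X$ of a good metric space to its normalized degree-Čech bifiltration $\mathcal{D\check C}(X)$ is discontinuous with respect to the Prohorov distance $d_{Pr}(\nu_X,\nu_Y)$ on normalized measures and $d_{HI}$; that is, there exist a good metric space $Z$ and non-empty finite subsets $Y$ and $Y^1,Y^2,\ldots$ of $Z$ with $d_{Pr}(\nu_{Y^n},\nu_Y)\to0$ as $n\to\infty$ but $d_{HI}(\mathcal{D\check C}(Y^n),\mathcal{D\check C}(Y))\not\to0$.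
   Context: **Good metric spaces.** A metric space is good if the intersection of any finite collection of open balls is either empty or contractible. $B(x,r)$ denotes the open ball of radius $r$ centered at $x$. **Measures.** For $X$ a non-empty finite metric space, $\mu_X$ is the uniform probability measure, $\mu_X(A)=|A|/|X|$. If $X\subset Z$ for a metric space $Z$, $\nu_X$ is the Borel measure on $Z$ given by $\nu_X(A)=|A\cap X|/|X|$. The Prohorov distance between Borel measures $\mu,\eta$ on a metric space $Z$ is \[ d_{Pr}(\mu,\eta)=\sup_A\inf\{\delta\ge 0 \mid \mu(A)\le\eta(A^\delta)+\delta \text{ and } \eta(A)\le\mu(A^\delta)+\delta\}, \] where $A\subset Z$ ranges over closed sets and $A^\delta$ is the set of points of $Z$ at distance $<\delta$ from some $a\in A$. The Gromov–Prohorov distance between metric measure spaces $\mathcal X,\mathcal Y$ with measures $\eta_{\mathcal X},\eta_{\mathcal Y}$ is $d_{GPr}(\mathcal X,\mathcal Y)=\inf_{\varphi,\psi}d_{Pr}(\varphi_*\eta_{\mathcal X},\psi_*\eta_{\mathcal Y})$, where $\varphi:\mathcal X\to W$, $\psi:\mathcal Y\to W$ range over isometric embeddings into a common metric space $W$; a metric measure space is denoted by its measure. **Bifiltrations.** $J=(0,\infty)^{\mathrm{op}}\times(0,\infty)$, so $(k,r)\le(k',r')$ iff $k\ge k'$ and $r\le r'$. All bifiltrations below are functors from $J$ to topological spaces with internal maps inclusions; simplicial complexes are regarded as spaces via geometric realization. - For $X\subset Z$, the Čech complex $\check{\mathcal C}(X)_r$ is the nerve of the balls $B(x,r)\subset Z$,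 $x\in X$: its vertex set is $X$ (balls are indexed by their centers), and its simplices are the non-empty finite $\sigma\subset X$ with $\bigcap_{x\in\sigma}B(x,r)\ne\emptyset$. - For a metric space $(X,\partial_X)$, the Rips complex $\mathcal R(X)_r$ is the clique complex of the graph with vertex set $X$ and edges $[x,y]$, $x\neq y$, $\partial_X(x,y)<2r$. - For a simplicial complex $T$ and $k>0$, $\mathcal D(T)_k$ is the maximum subcomplex of $T$ all of whose vertices have degree at least $k-1$ in the 1-skeleton of $T$. - For $X$ non-empty finite, $\mathcal{D\check C}(X)_{(k,r)}=\mathcal D(\check{\mathcal C}(X)_r)_{k|X|}$ and $\mathcal{DR}(X)_{(k,r)}=\mathcal D(\mathcal R(X)_r)_{k|X|}$. **Interleavings.** Let $\tau^\delta(x,y)=(x-\delta,y+\delta)$ on $\mathbb R^{\mathrm{op}}\times\mathbb R$, $\delta\ge0$ (ordered by $(a,b)\le(c,d)$ iff $a\ge c$ and $b\le d$). The thin category $\mathbf I^{\delta}$ has objects $J\times\{0,1\}$ and a morphism $(r,i)\to(s,j)$ iff either $i=j$ and $r\le s$, or $i\ne j$ and $\tau^\delta(r)\le s$. Functors $F,G:J\to\mathbf{Top}$ are $\delta$-interleaved if there is a functor $\mathbf I^{\delta}\to\mathbf{Top}$ restricting to $F$ on $J\times\{0\}$ and to $G$ on $J\times\{1\}$. Functors $J\to\mathbf{Top}$ are weakly equivalent if they are connected by a finite zigzag of natural transformations each of which is objectwise a weak homotopy equivalence. $F,G$ are $\delta$-homotopy interleaved if there are $F'$ weakly equivalent to $F$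 and $G'$ weakly equivalent to $G$ with $F',G'$ $\delta$-interleaved, and $d_{HI}(F,G)=\inf\{\delta\mid F,G\text{ are }\delta\text{-homotopy interleaved}\}$. *)

(* Defs.v *)
From HB Require Import structures.
From Stdlib Require Import Relation_Operators.
From mathcomp Require Import all_boot all_order all_algebra finmap.
From mathcomp Require Import all_classical all_reals all_analysis.
Set Implicit Arguments.
Unset Strict Implicit.
Unset Printing Implicit Defensive.
Import Order.TTheory GRing.Theory Num.Theory.
Import numFieldNormedType.Exports.
Local Open Scope classical_set_scope.
Local Open Scope ring_scope.

(* The library puts sigma-algebras on pointed types only. The choice of the
   base point is irrelevant below: it only records that the space is non-empty *)
#[short(type="pmetricType")]
HB.structure Definition PointedMetric (R : numDomainType) :=
  {M of Pointed M & Metric R M}.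

HB.instance Definition _ (R : realType) := Metric.on R^o.

Definition borel (R : numDomainType) (Z : pmetricType R) :=
  g_sigma_algebraType (@open Z).

Section Measures.
Context {R : realType}.

Lemma measurable_fset (Z : pmetricType R) (X : {fset Z}) :
  measurable ([set` X] : set (borel Z)).
Proof.
rewrite -[[set` X]]setCK; apply: measurableC; apply: sub_sigma_algebra.
apply: closed_openC.
have [+ _] := @accessible_finite_set_closed Z; apply.
  by apply: hausdorff_accessible; exact: metric_hausdorff.
exact: finite_fset.
Qed.

(* nu_X (A) = |A `&` X| / |X| *)
Definition fset_measure (Z : pmetricType R) (X : {fset Z}) :
    {measure set (borel Z) -> \bar R} :=
  mscale ((#|` X|%:R)^-1)%:nng (mrestr counting (measurable_fset X)).

(* mu_X; meaningful when X is finite *)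
Definition uniform_measure (X : pmetricType R) :
    {measure set (borel X) -> \bar R} :=
  fset_measure (fset_set [set: X]).

Definition thicken (Z : pmetricType R) (A : set Z) (d : R) : set Z :=
  [set z | exists2 a, A a & mdist a z < d].

Definition prohorov (Z : pmetricType R)
    (mu eta : {measure set (borel Z) -> \bar R}) : \bar R :=
  ereal_sup [set ereal_inf [set d%:E | d in
      [set d : R | [/\ 0 <= d,
         (mu A <= eta (thicken A d) + d%:E)%E &
         (eta A <= mu (thicken A d) + d%:E)%E]]]
    | A in (@closed Z : set (set Z))].

Record isometry (X W : pmetricType R) := Isometry {
  isometry_fun :> X -> W;
  isometryP : forall x y, mdist (isometry_fun x) (isometry_fun y) = mdist x y
}.

Lemma isometry_measurable (X W : pmetricType R) (f : isometry X W) :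
  measurable_fun [set: borel X] (f : borel X -> borel W).
Proof.
apply: measurability; first by [].
move=> _ [B oB <-]; rewrite setTI; apply: sub_sigma_algebra.
apply: open_comp => // x _; apply/cvg_ballP => e e0.
near=> y; rewrite ballEmdist/= isometryP.
have : ball x e y by near: y; exact: nbhsx_ballx.
by rewrite ballEmdist.
Unshelve. all: by end_near. Qed.

Section Push.
Variables (X W : pmetricType R) (f : isometry X W).
Variable mu : {measure set (borel X) -> \bar R}.

Definition push : set (borel W) -> \bar R :=
  pushforward mu (f : borel X -> borel W).

Let mf := isometry_measurable f.
Let push0 : push set0 = 0%E. Proof. exact: measure0. Qed.
Let push_ge0 A : (0 <= push A)%E. Proof. exact: measure_ge0. Qed.
Let push_sigma_additive : semi_sigma_additive push.
Proof. exact: (@measure_semi_sigma_additive _ _ _ (pushforward mu _)). Qed.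

HB.instance Definition _ := isMeasure.Build _ _ _ push
  push0 push_ge0 push_sigma_additive.

End Push.

Definition gromov_prohorov (X Y : pmetricType R)
    (mu : {measure set (borel X) -> \bar R})
    (eta : {measure set (borel Y) -> \bar R}) : \bar R :=
  ereal_inf [set d | exists (W : pmetricType R)
    (phi : isometry X W) (psi : isometry Y W),
    d = prohorov (push phi mu) (push psi eta)].

End Measures.

Section Homotopy.
Context {R : realType}.

Definition I01 : set R := `[0, 1].

(* [A] is contractible in itself, for the subspace topology *)
Definition contractible (X : topologicalType) (A : set X) : Prop :=
  exists (x0 : X) (H : R * X -> X), [/\ A x0,
    {within I01 `*` A, continuous H},
    forall t x, I01 t -> A x -> A (H (t, x)) &
    forall x, A x -> H (0, x) = x /\ H (1, x) = x0].

(* The empty collection, whose intersection is [Z], is included *)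
Definition good_metric (Z : metricType R) : Prop :=
  forall s : seq (Z * R),
    let A := \bigcap_(p in [set` s]) ball p.1 p.2 in
    A = set0 \/ contractible A.

Definition path_connected_points (X : topologicalType) (x y : X) : Prop :=
  exists g : R -> X, [/\ {within I01, continuous g}, g 0 = x & g 1 = y].

Definition cube n : set 'rV[R]_n := [set t | forall i, I01 (t 0 i)].
Definition cube_boundary n : set 'rV[R]_n :=
  [set t | cube t /\ exists i, t 0 i = 0 \/ t 0 i = 1].

(* Elements of pi_n (X, x) are represented by functions on R^n; only their
   values on the cube matter *)
Definition spheroid n (X : topologicalType) (x : X) (g : 'rV[R]_n -> X) : Prop :=
  {within cube (n := n), continuous g} /\ forall t, cube_boundary t -> g t = x.

Definition spheroid_homotopic n (X : topologicalType) (x : X)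
    (g h : 'rV[R]_n -> X) : Prop :=
  exists H : R * 'rV[R]_n -> X, [/\
    {within I01 `*` cube (n := n), continuous H},
    forall t, cube t -> H (0, t) = g t /\ H (1, t) = h t &
    forall s t, I01 s -> cube_boundary t -> H (s, t) = x].

(* Bijectivity of pi_0 (X) -> pi_0 (Y) and, for every n >= 1 and every base
   point x, of the homomorphism pi_n (X, x) -> pi_n (Y, f x) *)
Definition weak_homotopy_equivalence (X Y : topologicalType) (f : X -> Y) :
    Prop :=
  [/\ continuous f,
    forall x x', path_connected_points (f x) (f x') ->
      path_connected_points x x',
    forall y, exists x, path_connected_points (f x) y &
    forall n (x : X),
      (forall g h : 'rV[R]_n.+1 -> X, spheroid x g -> spheroid x h ->
         spheroid_homotopic (f x) (f \o g) (f \o h) ->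
         spheroid_homotopic x g h) /\
      (forall h : 'rV[R]_n.+1 -> Y, spheroid (f x) h ->
         exists2 g, spheroid x g & spheroid_homotopic (f x) (f \o g) h)].

End Homotopy.

Record functor d (I : preorderType d) := Functor {
  fobj :> I -> topologicalType;
  fmor : forall i j, (i <= j)%O -> fobj i -> fobj j;
  fmor_continuous : forall i j (ij : (i <= j)%O), continuous (fmor ij);
  fmor_id : forall i (ii : (i <= i)%O) x, fmor ii x = x;
  fmor_comp : forall i j k (ij : (i <= j)%O) (jk : (j <= k)%O)
    (ik : (i <= k)%O) x, fmor ik x = fmor jk (fmor ij x)
}.

Section Functors.
Context {d d' : Order.disp_t} (I : preorderType d) (I' : preorderType d').

Definition precomp (phi : I -> I') (phi_mono : {homo phi : i j / (i <= j)%O})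
    (F : functor I') : functor I :=
  @Functor d I (fun i => F (phi i))
    (fun i j ij => @fmor _ _ F _ _ (phi_mono i j ij))
    (fun i j ij => @fmor_continuous _ _ F _ _ (phi_mono i j ij))
    (fun i ii => @fmor_id _ _ F _ (phi_mono i i ii))
    (fun i j k ij jk ik => @fmor_comp _ _ F _ _ _
       (phi_mono i j ij) (phi_mono j k jk) (phi_mono i k ik)).

Definition natural_weak_equivalence (R : realType) (F G : functor I) : Prop :=
  exists eta : forall i, F i -> G i,
    (forall i j (ij : (i <= j)%O) x,
       eta j (fmor ij x) = fmor ij (eta i x)) /\
    (forall i, weak_homotopy_equivalence (R := R) (eta i)).

Definition weakly_equivalent (R : realType) : functor I -> functor I -> Prop :=
  clos_refl_sym_trans (functor I) (natural_weak_equivalence R).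

End Functors.

Section Interleavings.
Context {R : realType}.

(* The order of R^op x R: the first coordinate is reversed *)
Definition le_opR (a b : R * R) : bool := (b.1 <= a.1) && (a.2 <= b.2).

Lemma le_opR_refl : reflexive le_opR.
Proof. by move=> a; rewrite /le_opR !lexx. Qed.

Lemma le_opR_trans : transitive le_opR.
Proof.
move=> b a c /andP[ab1 ab2] /andP[bc1 bc2].
by rewrite /le_opR (le_trans bc1)// (le_trans ab2).
Qed.

Definition tau (d : R) (a : R * R) : R * R := (a.1 - d, a.2 + d).

Lemma le_opR_tau d a b : le_opR a b -> le_opR (tau d a) (tau d b).
Proof. by rewrite /le_opR /= lerD2r lerD2r. Qed.

Lemma le_tau d a : 0 <= d -> le_opR a (tau d a).
Proof. by move=> d0; rewrite /le_opR /= gerBl lerDl d0. Qed.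

End Interleavings.

(* J = (0, +oo)^op x (0, +oo) *)
Definition J (R : realType) := ({posnum R} * {posnum R})%type.

Definition J_val (R : realType) (j : J R) : R * R := (j.1%:num, j.2%:num).

Definition le_J (R : realType) (a b : J R) := le_opR (J_val a) (J_val b).

HB.instance Definition _ (R : realType) := Choice.on (J R).
HB.instance Definition _ (R : realType) :=
  @Order.Le_isPreorder.Build Order.default_display (J R) (@le_J R)
    (fun a => le_opR_refl (J_val a)) (fun b a c => @le_opR_trans R _ _ _).

(* I^delta; the copies J x {0} and J x {1} are indexed by false and true *)
Definition interleaving_cat (R : realType) (d : {nonneg R}) := (J R * bool)%type.

Definition le_interleaving (R : realType) (d : {nonneg R})
    (p q : interleaving_cat d) : bool :=
  if p.2 == q.2 then (p.1 <= q.1)%O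
  else le_opR (tau d%:num (J_val p.1)) (J_val q.1).

Lemma le_interleaving_refl (R : realType) (d : {nonneg R}) :
  reflexive (@le_interleaving R d).
Proof. by move=> p; rewrite /le_interleaving eqxx; exact: le_opR_refl. Qed.

Lemma le_interleaving_trans (R : realType) (d : {nonneg R}) :
  transitive (@le_interleaving R d).
Proof.
have d0 : 0 <= d%:num by [].
move=> [b j] [a i] [c k]; rewrite /le_interleaving /=.
rewrite -![(_ <= _)%O]/(le_opR (J_val _) (J_val _)).
have tautau x : le_opR x (tau d%:num (tau d%:num x)).
  exact: le_opR_trans (le_tau _ d0) (le_tau _ d0).
case: i; case: j; case: k => //=; try exact: le_opR_trans.
- move=> ab bc; exact: le_opR_trans (le_opR_tau _ ab) bc.
- move=> ab bc; apply: le_opR_trans bc; apply: le_opR_trans (le_opR_tau _ ab).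
  exact: tautau.
- move=> ab bc; apply: le_opR_trans bc; apply: le_opR_trans (le_opR_tau _ ab).
  exact: tautau.
- move=> ab bc; exact: le_opR_trans (le_opR_tau _ ab) bc.
Qed.

HB.instance Definition _ (R : realType) (d : {nonneg R}) :=
  Choice.on (interleaving_cat d).
HB.instance Definition _ (R : realType) (d : {nonneg R}) :=
  @Order.Le_isPreorder.Build Order.default_display (interleaving_cat d)
    (@le_interleaving R d) (@le_interleaving_refl R d)
    (@le_interleaving_trans R d).

Section InterleavingDistance.
Context {R : realType}.

Definition J_copy (d : {nonneg R}) (b : bool) (j : J R) : interleaving_cat d :=
  (j, b).

Lemma J_copy_mono d b : {homo J_copy d b : i j / (i <= j)%O}.
Proof. by move=> i j ij; rewrite /Order.le /= /le_interleaving eqxx. Qed.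

Definition interleaved (d : {nonneg R}) (F G : functor (J R)) : Prop :=
  exists H : functor (interleaving_cat d),
    precomp (@J_copy_mono d false) H = F /\ precomp (@J_copy_mono d true) H = G.

Definition homotopy_interleaved (d : {nonneg R}) (F G : functor (J R)) : Prop :=
  exists F' G', [/\ weakly_equivalent R F' F, weakly_equivalent R G' G &
    interleaved d F' G'].

Definition d_HI (F G : functor (J R)) : \bar R :=
  ereal_inf [set d%:num%:E | d in [set d : {nonneg R} |
    homotopy_interleaved d F G]].

End InterleavingDistance.

Record complex (V : choiceType) := Complex {
  simplex :> {fset V} -> Prop;
  simplex_neq0 : forall s, simplex s -> s != fset0;
  simplex_face : forall s t, simplex s -> (t `<=` s)%fset -> t != fset0 ->
    simplex t
}.

(* Points are given by their barycentric coordinates *)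
Definition realization (R : realType) (V : choiceType) (K : complex V) :=
  {a : V -> R | (forall v, 0 <= a v) /\
    exists s, [/\ K s, [set v | a v != 0] = [set` s] & \sum_(v <- s) a v = 1]}.

Section Realization.
Context {R : realType} {V : choiceType} (K : complex V).

Definition closed_face (s : {fset V}) : set (realization R K) :=
  [set a | forall v, v \notin s -> sval a v = 0].

(* The weak topology: a set is open when it is open in every closed face, the
   latter having its Euclidean topology, inherited from R^V *)
Definition realization_open (U : set (realization R K)) : Prop :=
  forall s, K s -> exists2 D : set {ptws V -> R}, open D &
    U `&` closed_face s = [set a | D (sval a)] `&` closed_face s.

Let realization_openT : realization_open setT.
Proof. by move=> s _; exists setT; [exact: openT|]. Qed.

Let realization_openI : setI_closed realization_open.
Proof.
move=> A B oA oB s Ks; have [D oO AO] := oA s Ks; have [P oP BP] := oB s Ks.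
exists (D `&` P); first exact: openI.
by rewrite setIIl AO BP -setIIl.
Qed.

Let realization_open_bigU (I : Type) (f : I -> set (realization R K)) :
  (forall i, realization_open (f i)) -> realization_open (\bigcup_i f i).
Proof.
move=> fo s Ks.
pose P i (D : set {ptws V -> R}) := open D /\
  f i `&` closed_face s = [set a | D (sval a)] `&` closed_face s.
have [D Df] : {D : I -> set {ptws V -> R} & forall i, P i (D i)}.
  by apply: boolp.choice => i; have [D ? ?] := fo i s Ks; exists D.
exists (\bigcup_i D i); first by apply: bigcup_open => i _; exact: (Df i).1.
apply/seteqP; split => a [[i _ ia] sa]; split => //; exists i => //.
  have : (f i `&` closed_face s) a by [].
  by rewrite (Df i).2 => -[].
have : ([set a | D i (sval a)] `&` closed_face s) a by [].
by rewrite -(Df i).2 => -[].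
Qed.

HB.instance Definition _ := gen_eqMixin (realization R K).
HB.instance Definition _ := gen_choiceMixin (realization R K).
HB.instance Definition _ := isOpenTopological.Build (realization R K)
  realization_openT realization_openI realization_open_bigU.

Lemma realization_openE (U : set (realization R K)) :
  open U = realization_open U.
Proof. by []. Qed.

End Realization.

Section Subcomplexes.
Context {R : realType} {V : choiceType}.
Implicit Types (K L T : complex V).

Definition subcomplex K L : Prop := forall s, K s -> L s.

Definition realization_incl K L (KL : subcomplex K L)
    (a : realization R K) : realization R L :=
  exist _ (sval a) (let: conj a_ge0 (ex_intro s (And3 Ks supp sum1)) := svalP a in
    conj a_ge0 (ex_intro _ s (And3 (KL s Ks) supp sum1))).

Lemma realization_incl_continuous K L (KL : subcomplex K L) :
  continuous (realization_incl KL).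
Proof.
apply/continuousP => U; rewrite !realization_openE => oU s Ks.
have [D oO UO] : exists2 D : set {ptws V -> R}, open D &
    U `&` @closed_face R V L s = [set a | D (sval a)] `&` @closed_face R V L s.
  by apply: oU; exact: KL.
exists D => //; apply/seteqP; split => a [aU sa]; split => //.
  have : (U `&` @closed_face R V L s) (realization_incl KL a) by [].
  by rewrite UO => -[].
have : ([set a | D (sval a)] `&` @closed_face R V L s) (realization_incl KL a).
  by [].
by rewrite -UO => -[].
Qed.

Lemma realization_inj K (a b : realization R K) : sval a = sval b -> a = b.
Proof.
case: a b => [a Ka] [b Kb] /= ab; case: _ / ab in Kb *.
by congr exist; exact: Prop_irrelevance.
Qed.

Lemma realization_incl_id K (KK : subcomplex K K) (a : realization R K) :
  realization_incl KK a = a.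
Proof. exact: realization_inj. Qed.

Lemma realization_incl_comp K L T (KL : subcomplex K L) (LT : subcomplex L T)
    (KT : subcomplex K T) (a : realization R K) :
  realization_incl KT a = realization_incl LT (realization_incl KL a).
Proof. exact: realization_inj. Qed.

(* The number of edges at [v], possibly infinite *)
Definition degree T (v : V) : \bar R :=
  counting [set w | w != v /\ T [fset v; w]%fset].

Definition has_degrees T (k : R) L : Prop :=
  subcomplex L T /\ forall v, L [fset v]%fset -> ((k - 1)%:E <= degree T v)%E.

(* The maximum subcomplex is the union of all of those under consideration *)
Definition degree_simplex T (k : R) (s : {fset V}) : Prop :=
  exists2 L, has_degrees T k L & L s.

Lemma degree_simplex_neq0 T k s : degree_simplex T k s -> s != fset0.
Proof. by case=> L _ /simplex_neq0. Qed.

Lemma degree_simplex_face T k s t : degree_simplex T k s -> (t `<=` s)%fset ->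
  t != fset0 -> degree_simplex T k t.
Proof. by case=> L TL Ls ts t0; exists L => //; exact: simplex_face ts t0. Qed.

Definition degree_complex T (k : R) : complex V :=
  Complex (@degree_simplex_neq0 T k) (@degree_simplex_face T k).

Lemma degree_complex_max T k :
  has_degrees T k (degree_complex T k) /\
  forall L, has_degrees T k L -> subcomplex L (degree_complex T k).
Proof.
split; last by move=> L TL s Ls; exists L.
by split=> [s [L [LT _] /LT//]|v [L [_ +] Lv]]; exact.
Qed.

Lemma counting_le (A B : set V) : A `<=` B ->
  (counting A <= counting B :> \bar R)%E.
Proof.
move=> AB; rewrite /counting; case: (asboolP (finite_set B)) => [fB|_]; last by rewrite leey.
rewrite asboolT; last exact: sub_finite_set fB.
rewrite lee_fin ler_nat; apply: fsubset_leq_card.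
by rewrite -fset_set_sub//; exact: sub_finite_set fB.
Qed.

Lemma degree_complex_mono T T' k k' : subcomplex T T' -> k' <= k ->
  subcomplex (degree_complex T k) (degree_complex T' k').
Proof.
move=> TT' kk' s [L [LT Lk] Ls]; exists L => //; split.
  by move=> t /LT /TT'.
move=> v /Lk h; apply: le_trans (le_trans h _).
  by rewrite lee_fin lerB.
by apply: counting_le => w [wv] /TT'.
Qed.

End Subcomplexes.

Section Bifiltrations.
Context {R : realType}.

Definition filtration (V : choiceType) (K : J R -> complex V)
    (K_mono : forall i j, (i <= j)%O -> subcomplex (K i) (K j)) :
    functor (J R) :=
  @Functor _ (J R) (fun j => realization R (K j))
    (fun i j ij => realization_incl (K_mono i j ij))
    (fun i j ij => @realization_incl_continuous R V _ _ (K_mono i j ij))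
    (fun i ii a => realization_incl_id (K_mono i i ii) a)
    (fun i j k ij jk ik a =>
       realization_incl_comp (K_mono i j ij) (K_mono j k jk) (K_mono i k ik) a).

Section Cech.
Variable Z : metricType R.
Implicit Types (X : {fset Z}) (r : R).

Definition cech_simplex X r (s : {fset Z}) : Prop :=
  [/\ s != fset0, (s `<=` X)%fset &
    exists z, forall x, x \in s -> ball x r z].

Lemma cech_simplex_neq0 X r s : cech_simplex X r s -> s != fset0.
Proof. by case. Qed.

Lemma cech_simplex_face X r s t : cech_simplex X r s -> (t `<=` s)%fset ->
  t != fset0 -> cech_simplex X r t.
Proof.
move=> [_ sX [z sz]] ts t0; split => //; first exact: fsubset_trans ts sX.
by exists z => x /(fsubsetP ts); exact: sz.
Qed.

Definition cech X r : complex Z :=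
  Complex (@cech_simplex_neq0 X r) (@cech_simplex_face X r).

Definition degree_cech X (j : J R) : complex Z :=
  degree_complex (cech X j.2%:num) (j.1%:num * #|` X|%:R).

Lemma degree_cech_mono X i j : (i <= j)%O ->
  subcomplex (degree_cech X i) (degree_cech X j).
Proof.
move=> /andP[kk rr]; apply: degree_complex_mono; last exact: ler_wpM2r.
move=> s [s0 sX [z sz]]; split => //; exists z => x /sz.
by apply: le_ball.
Qed.

Definition DC X : functor (J R) := filtration (@degree_cech_mono X).

End Cech.

Section Rips.

Definition clique_simplex (V : choiceType) (e : rel V) (s : {fset V}) : Prop :=
  s != fset0 /\ forall x y, x \in s -> y \in s -> x != y -> e x y.

Lemma clique_simplex_neq0 (V : choiceType) (e : rel V) s :
  clique_simplex e s -> s != fset0.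
Proof. by case. Qed.

Lemma clique_simplex_face (V : choiceType) (e : rel V) s t :
  clique_simplex e s -> (t `<=` s)%fset -> t != fset0 -> clique_simplex e t.
Proof.
by move=> [_ es] /fsubsetP ts t0; split => // x y /ts xs /ts ys; exact: es.
Qed.

(* The clique complex of the graph with vertex set the whole of [V] *)
Definition clique_complex (V : choiceType) (e : rel V) : complex V :=
  Complex (@clique_simplex_neq0 V e) (@clique_simplex_face V e).

Variable X : metricType R.

Definition rips (r : R) : complex X :=
  clique_complex [rel x y | (x != y) && (mdist x y < 2 * r)].

(* Meaningful when [X] is finite, in which case the cardinal is that of [X] *)
Definition degree_rips (j : J R) : complex X :=
  degree_complex (rips j.2%:num) (j.1%:num * #|` fset_set [set: X]|%:R).

Lemma degree_rips_mono i j : (i <= j)%O ->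
  subcomplex (degree_rips i) (degree_rips j).
Proof.
move=> /andP[kk rr]; apply: degree_complex_mono; last exact: ler_wpM2r.
move=> s [s0 es]; split => // x y xs ys xy /=.
have /andP[-> /lt_le_trans] := es x y xs ys xy; apply.
by rewrite ler_pM2l.
Qed.

Definition DR : functor (J R) := filtration degree_rips_mono.

End Rips.

End Bifiltrations.

(* Main.v *)
(* Emptiness of a space is invariant under weak equivalence, so a d-homotopy
   interleaving of F and G forces G to be non-empty at (k - d, r + d) whenever F
   is non-empty at (k, r). On the real line, let Y be {-1, 1} and let Y^n consist
   of the point 0, of n + 1 points clustering at 1 and of n + 1 points clustering
   at -1. The single point 0 has vanishing mass, but it is within distance 1 of
   every point of Y^n, while the two points of Y are at distance 2: for k = 1 and
   1/2 < r <= 1 the degree complexes of Y^n contain the vertex 0, whereas those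
   of Y are empty as soon as k > 1/2 and r <= 1. *)
From HB Require Import structures.
Require Import Defs.
From mathcomp Require Import all_boot all_order all_algebra finmap.
From mathcomp Require Import all_classical all_reals all_analysis.
From mathcomp Require Import ring lra.
Import Order.TTheory GRing.Theory Num.Theory.
Import numFieldNormedType.Exports.
Local Open Scope classical_set_scope.
Local Open Scope ring_scope.

Set Implicit Arguments.
Unset Strict Implicit.
Unset Printing Implicit Defensive.

(** * Emptiness as an obstruction to homotopy interleaving *)

Lemma weakly_equivalent_inhabited (R : realType) d (I : preorderType d)
    (F G : functor I) (i : I) :
  weakly_equivalent R F G -> inhabited (F i) <-> inhabited (G i).
Proof.
elim=> {F G} [F G [eta [_ /(_ i)[_ _ surj _]]]|F|F G _ FG|F G H _ FG _ GH].
- by split=> -[x]; [split; exact: eta i x|have [y _] := surj x].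
- by [].
- exact: iff_sym.
- exact: iff_trans FG GH.
Qed.

(** The morphism from [(i, false)] to [(j, true)] in the interleaving category is sent to a map
    between the replacements of [F] and [G], and such a map carries points to points. *)
Lemma homotopy_interleaved_inhabited (R : realType) (d : {nonneg R})
    (F G : functor (J R)) (i j : J R) :
  homotopy_interleaved d F G -> le_opR (tau d%:num (J_val i)) (J_val j) ->
  inhabited (F i) -> inhabited (G j).
Proof.
move=> [F' [G' [FF' GG' [H [HF HG]]]]] ij.
rewrite -(weakly_equivalent_inhabited i FF').
rewrite -(weakly_equivalent_inhabited j GG') -{}HF -{}HG => -[x]; split.
exact: (@fmor _ _ H (i, false) (j, true) ij x).
Qed.

(** The distances cannot drop below [e]: an interleaving with [d < e] would transport a point of
    [F n i] into the region where [G] is empty. The bound [e <= i.1] keeps the shifted index inside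
    [J]. *)
Lemma d_HI_not_cvg0 (R : realType) (F : nat -> functor (J R))
    (G : functor (J R)) (i : J R) (e : R) :
  0 < e -> e <= i.1%:num -> (forall n, inhabited (F n i)) ->
  (forall j, i.1%:num - e < j.1%:num -> j.2%:num < i.2%:num + e ->
     ~ inhabited (G j)) ->
  ~ ((fun n => d_HI (F n) G) @ \oo --> 0%E).
Proof.
move=> e0 ei Fi Gj FG.
have [n /ereal_inf_lt[_ [d dFG <-]]] : exists n, (d_HI (F n) G < e%:E)%E.
  have : \forall n \near \oo, (d_HI (F n) G < e%:E)%E.
    by apply: (FG [set x | (x < e%:E)%E]); apply: open_nbhs_nbhs; split;
      [exact: open_ereal_lt_ereal|rewrite /= lte_fin].
  by case=> m _ /(_ m (leqnn m)); exists m.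
rewrite lte_fin => de.
have k0 : 0 < i.1%:num - d%:num by rewrite subr_gt0 (lt_le_trans de).
have r0 : 0 < i.2%:num + d%:num by rewrite ltr_wpDr.
(* The target index is exactly the shift of [i] by [d], so reflexivity gives the comparison. *)
have := homotopy_interleaved_inhabited (j := (PosNum k0, PosNum r0)) dFG.
move=> /(_ i (le_opR_refl _) (Fi n)); apply: Gj => /=.
  by rewrite ltrD2l ltrN2.
by rewrite ltrD2l.
Qed.

(** * Points of realizations and vertices of degree complexes *)

Section Realization.
Context (R : realType) (V : choiceType).
Implicit Types (K T : complex V) (v w : V).

Lemma realization_inhabited K :
  inhabited (realization R K) <-> exists v, K [fset v]%fset.
Proof.
split=> [[[a [_ [s [Ks _ _]]]]]|[v Kv]].
  have /fset0Pn[v vs] := simplex_neq0 Ks.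
  exists v; apply: simplex_face Ks _ _; first by rewrite fsub1set.
  by apply/fset0Pn; exists v; rewrite inE.
split; exists (fun w => (w == v)%:R); split=> [w|]; first exact: ler0n.
exists [fset v]%fset; split => //; last by rewrite big_seq_fset1 eqxx.
by apply/seteqP; split=> w /=; rewrite inE pnatr_eq0 eqb0 negbK.
Qed.

Definition vertex_simplex v (s : {fset V}) : Prop := s = [fset v]%fset.

Lemma vertex_simplex_neq0 v s : vertex_simplex v s -> s != fset0.
Proof. by move=> ->; apply/fset0Pn; exists v; rewrite inE. Qed.

Lemma vertex_simplex_face v s t : vertex_simplex v s -> (t `<=` s)%fset ->
  t != fset0 -> vertex_simplex v t.
Proof. by move=> ->; rewrite fsubset1 => /orP[/eqP|/eqP->]//; rewrite eqxx. Qed.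

Definition vertex_complex v : complex V :=
  Complex (@vertex_simplex_neq0 v) (@vertex_simplex_face v).

(** Degrees are measured in [T] and not in the subcomplex, so a vertex of large degree is by itself
    an admissible subcomplex. *)
Lemma degree_complex_vertex T (k : R) v : T [fset v]%fset ->
  degree_complex T k [fset v]%fset <-> ((k - 1)%:E <= degree T v)%E.
Proof.
move=> Tv; split=> [|kv]; first exact: (degree_complex_max T k).1.2.
exists (vertex_complex v) => //; split=> [s ->//|w].
by move/fset1_inj->.
Qed.

Lemma degree_ge T v (s : {fset V}) :
  (forall w, w \in s -> w != v /\ T [fset v; w]%fset) ->
  (#|` s|%:R%:E <= degree T v :> \bar R)%E.
Proof.
move=> sT.
apply: le_trans (counting_le (A := [set` s]) _); last by move=> w /sT.
by rewrite /counting asboolT// set_fsetK.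
Qed.

Lemma degree_eq0 T v : (forall w, w != v -> ~ T [fset v; w]%fset) ->
  degree T v = 0%E :> \bar R.
Proof.
move=> nT; rewrite /degree.
have -> : [set w | w != v /\ T [fset v; w]%fset] = set0.
  by apply/seteqP; split => // w [/nT].
by rewrite /counting asboolT// fset_set0.
Qed.

End Realization.

(** * Prohorov estimate for clusters with one outlier *)

Section Prohorov.
Context (R : realType).

Lemma sum_option (V : nmodType) (T : finType) (F : option T -> V) :
  \sum_t F t = F None + \sum_x F (Some x).
Proof.
rewrite (bigD1 None)//=; congr (_ + _); rewrite (reindex_omap Some id)//=.
  by apply: eq_bigl => x; rewrite eqxx.
by case.
Qed.

(** Here [a] is the number of centres, [b] the cluster size and [s] the number of centres in a given
    set. The masses [s / a] and [b * s / (a * b + 1)] differ by [s / a] times the mass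
    [(a * b + 1)^-1] of a single point, hence by at most that mass. *)
Lemma outlier_bounds (a b s d : R) : 0 < a -> 0 <= b -> 0 <= s <= a ->
  (a * b + 1)^-1 <= d ->
  (a * b + 1)^-1 * (1 + b * s) <= a^-1 * s + d /\
  a^-1 * s <= (a * b + 1)^-1 * (b * s) + d.
Proof.
move=> a0 b0 /andP[s0 sa] cd.
have c0 : 0 < a * b + 1 by rewrite ltr_wpDl// mulr_ge0// ltW.
have e : a^-1 * s = (a * b + 1)^-1 * (b * s) + (a * b + 1)^-1 * (s / a).
  by field; rewrite !gt_eqF.
have q0 : 0 <= (a * b + 1)^-1 * (s / a) by rewrite !mulr_ge0// invr_ge0 ltW.
have q1 : (a * b + 1)^-1 * (s / a) <= (a * b + 1)^-1.
  by rewrite ler_piMr ?invr_ge0 ?(ltW c0)// ler_pdivrMr// mul1r.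
rewrite e; lra.
Qed.

Section Bounds.
Variable Z : pmetricType R.
Implicit Types (mu eta : {measure set (borel Z) -> \bar R}) (X : {fset Z}).

Lemma fset_measureE X (A : set Z) :
  fset_measure X A = (#|` X|%:R^-1 * \sum_(x <- X) (x \in A)%:R)%:E.
Proof.
have fA : finite_set (A `&` [set` X]) by exact: finite_setIr.
have -> : fset_measure X A =
    ((#|` X|%:R^-1)%:E * counting (A `&` [set` X]))%E by [].
rewrite /counting asboolT// EFinM; congr (_ * _%:E)%E.
have -> : fset_set (A `&` [set` X]) = [fset x in X | x \in A]%fset.
  apply/fsetP => x; rewrite in_fset_set// !inE /=.
  apply/idP/idP => [/set_mem[Ax Xx]|/andP[Xx /set_mem Ax]].
    by rewrite Xx mem_set.
  exact: mem_set.
rewrite card_fset_sum1 natr_sum big_fset big_mkcond.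
by apply: eq_bigr => x _; case: ifP.
Qed.

Lemma prohorov_ge0 mu eta : (0 <= prohorov mu eta)%E.
Proof.
apply: (@le_trans _ _ (ereal_inf [set d%:E | d in
      [set d : R | [/\ 0 <= d,
         (mu set0 <= eta (thicken (set0 : set Z) d) + d%:E)%E &
         (eta set0 <= mu (thicken (set0 : set Z) d) + d%:E)%E]]])).
  by apply: le_ereal_inf_tmp => _ [d [d0 _ _] <-]; rewrite lee_fin.
by apply: ereal_sup_ubound; exists set0 => //; exact: closed0.
Qed.

Lemma prohorov_le mu eta (d : R) : 0 <= d ->
  (forall A : set Z, (mu A <= eta (thicken A d) + d%:E)%E /\
                     (eta A <= mu (thicken A d) + d%:E)%E) ->
  (prohorov mu eta <= d%:E)%E.
Proof.
move=> d0 mueta; apply: ge_ereal_sup => _ [A _ <-].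
by apply: ereal_inf_lbound; exists d => //; have [] := mueta A.
Qed.

(* [f] blows every point [g i] up to [N] nearby points and adds the outlier
   [f None] *)
Lemma prohorov_outlier (I : finType) (N : nat) (f : option (I * 'I_N) -> Z)
    (g : I -> Z) (d : R) :
  (0 < #|I|)%N -> injective f -> injective g ->
  (forall i k, mdist (f (Some (i, k))) (g i) < d) ->
  (#|I| * N).+1%:R^-1 <= d ->
  (prohorov (fset_measure [fset f t | t in {: option (I * 'I_N)}]%fset)
            (fset_measure [fset g i | i in {: I}]%fset) <= d%:E)%E.
Proof.
move=> I0 injf injg fg dN.
have d0 : 0 <= d by apply: le_trans dN; rewrite invr_ge0.
apply: prohorov_le => // A.
rewrite !fset_measureE !big_imfset//=;
  try by move=> *; apply/injf || apply/injg.
rewrite !card_imfset//= -!cardE !card_option card_prod card_ord !big_enum/=.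
rewrite -!EFinD !lee_fin !sum_option.
(* [S B] counts the centres lying in [B]; both measures are compared through it. *)
pose S (B : set Z) : R := \sum_i (g i \in B)%:R.
have S_bounds B : 0 <= S B <= #|I|%:R.
  rewrite sumr_ge0//= -sum1_card natr_sum; apply: ler_sum => i _.
  by rewrite ler_nat leq_b1.
have aI : 0 < #|I|%:R :> R by rewrite ltr0n.
have := dN; rewrite -natr1 natrM => dN'.
have mulS B : N%:R * S B = \sum_i \sum_(k < N) (g i \in B)%:R.
  rewrite mulr_sumr; apply: eq_bigr => i _.
  by rewrite sumr_const card_ord mulr_natl.
(* A cluster point in [A] puts its centre in the thickening, and the outlier adds at most one point.
   Conversely, a centre in [A] puts its whole cluster in the thickening, and the outlier may be
   discarded. *)
split.
  apply: le_trans (outlier_bounds aI (ler0n _ N) (S_bounds _) dN').1.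
  apply: ler_wpM2l; first by rewrite invr_ge0 ltW// ltr_wpDl// mulr_ge0.
  apply: lerD; first by case: (_ \in _).
  rewrite mulS pair_bigA /=; apply: ler_sum => -[i k] _ /=.
  rewrite ler_nat; have [/set_mem Af|//] := boolP (f _ \in A).
  by rewrite mem_set//; exists (f (Some (i, k))).
apply: le_trans (outlier_bounds aI (ler0n _ N) (S_bounds A) dN').2 _.
rewrite lerD2r; apply: ler_wpM2l.
  by rewrite invr_ge0 ltW// ltr_wpDl// mulr_ge0.
rewrite mulS pair_bigA /= ler_wpDl//; apply: ler_sum => -[i k] _ /=.
rewrite ler_nat; have [/set_mem Ag|//] := boolP (g _ \in A).
by rewrite mem_set//; exists (g i) => //; rewrite metric_sym.
Qed.

End Bounds.

End Prohorov.

Lemma degree_complex_inhabited (R : realType) (V : choiceType) (T : complex V)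
    (k : R) :
  inhabited (realization R (degree_complex T k)) <->
  exists2 v, T [fset v]%fset & ((k - 1)%:E <= degree T v)%E.
Proof.
split=> [/realization_inhabited[v kv]|[v Tv kv]].
  have Tv : T [fset v]%fset by case: kv => L [LT _] /LT.
  by exists v => //; apply/(degree_complex_vertex k Tv).
by apply/realization_inhabited; exists v; apply/degree_complex_vertex.
Qed.

(** * Criteria for stages of the two bifiltrations to be non-empty or empty *)

Section Inhabited.
Context (R : realType).

(** The vertex [x] is joined to all other points, so its degree is [|X| - 1], which is at least
    [k * |X| - 1] since [k <= 1]. *)
Lemma DC_inhabited (Z : metricType R) (X : {fset Z}) (j : J R) x :
  x \in X -> j.1%:num <= 1 ->
  (forall y, y \in X -> exists z, ball x j.2%:num z /\ ball y j.2%:num z) ->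
  inhabited (DC X j).
Proof.
move=> xX k1 xz; apply/degree_complex_inhabited; exists x.
  split; [by apply/fset0Pn; exists x; rewrite inE|by rewrite fsub1set|].
  by exists x => y; rewrite inE => /eqP->; exact: ballxx.
apply: (le_trans _ (degree_ge R (s := (X `\ x)%fset) _)) => [|y]; last first.
  rewrite !inE => /andP[yx yX]; split => //; split.
  - by apply/fset0Pn; exists x; rewrite !inE eqxx.
  - by apply/fsubsetP => w; rewrite !inE => /orP[]/eqP->.
  - have [z [xz' yz]] := xz y yX.
    by exists z => w; rewrite !inE => /orP[]/eqP->.
have cX : #|` X|%:R = 1 + #|` (X `\ x)%fset|%:R :> R.
  by rewrite (cardfsD1 x) xX natrD.
by rewrite lee_fin lerBlDl -cX ler_piMl.
Qed.

(** Without edges every degree is 0, below the threshold [k * |X| - 1]. *)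
Lemma DC_empty (Z : metricType R) (X : {fset Z}) (j : J R) :
  1 < j.1%:num * #|` X|%:R ->
  (forall x y z, x \in X -> y \in X -> y != x -> ball x j.2%:num z ->
     ~ ball y j.2%:num z) ->
  ~ inhabited (DC X j).
Proof.
move=> k1 nz /degree_complex_inhabited[x _]; rewrite degree_eq0.
  by rewrite lee_fin subr_le0 leNgt k1.
move=> y yx [_ /fsubsetP sX [z xyz]].
by apply: (nz x y z); rewrite ?yx//; (apply: sX || apply: xyz);
  rewrite !inE eqxx ?orbT.
Qed.

Lemma DR_inhabited (X : metricType R) (j : J R) (x : X) :
  finite_set [set: X] -> j.1%:num <= 1 ->
  (forall y, mdist x y < 2 * j.2%:num) -> inhabited (DR X j).
Proof.
move=> fX k1 xy; apply/degree_complex_inhabited; exists x.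
  split; first by apply/fset0Pn; exists x; rewrite inE.
  by move=> y z; rewrite !inE => /eqP-> /eqP->; rewrite eqxx.
pose s := (fset_set [set: X] `\ x)%fset.
apply: (le_trans _ (degree_ge R (s := s) _)) => [|y]; last first.
  rewrite !inE => /andP[yx _]; split => //; split.
    by apply/fset0Pn; exists x; rewrite !inE eqxx.
  move=> v w; rewrite !inE => /orP[]/eqP-> /orP[]/eqP->;
    rewrite ?eqxx// => _ /=.
    by rewrite eq_sym yx xy.
  by rewrite yx metric_sym xy.
have cX : #|` fset_set [set: X]|%:R =
    1 + #|` s|%:R :> R.
  by rewrite (cardfsD1 x) in_fset_set// mem_set// natrD.
by rewrite lee_fin lerBlDl -cX ler_piMl.
Qed.

Lemma DR_empty (X : metricType R) (j : J R) :
  1 < j.1%:num * #|` fset_set [set: X]|%:R ->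
  (forall x y : X, y != x -> 2 * j.2%:num <= mdist x y) ->
  ~ inhabited (DR X j).
Proof.
move=> k1 xy /degree_complex_inhabited[x _]; rewrite degree_eq0.
  by rewrite lee_fin subr_le0 leNgt k1.
move=> y yx [_ /(_ x y)]; rewrite !inE !eqxx orbT eq_sym => /(_ isT isT yx) /=.
by rewrite ltNge xy// andbF.
Qed.

End Inhabited.

(** * Finite subsets as metric spaces in their own right *)

Section FsetSpace.
Context (R : realType) (Z : pmetricType R) (X : {fset Z}) (x0 : X).

(* The base point has to be read off the type by instance inference *)
Definition fset_space : Type := let _ := x0 in X.

HB.instance Definition _ := Choice.on fset_space.
HB.instance Definition _ := isPointed.Build fset_space x0.

Let dist (x y : fset_space) : R := mdist (val (x : X)) (val (y : X)).

Let distxx x : dist x x = 0. Proof. exact: mdistxx. Qed.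

Let dist_positivity x y : dist x y = 0 -> x = y.
Proof. by move=> /mdist_positivity/val_inj. Qed.

Let dist_sym x y : dist x y = dist y x. Proof. exact: metric_sym. Qed.

Let dist_triangle y x z : dist x z <= dist x y + dist y z.
Proof. exact: metric_triangle. Qed.

HB.instance Definition _ := isMetric.Build R fset_space
  distxx dist_positivity dist_sym dist_triangle.

Definition fset_isometry : Defs.isometry fset_space Z :=
  @Isometry R fset_space Z (val : X -> Z) (fun _ _ => erefl).

Lemma finite_fset_space : finite_set [set: fset_space].
Proof. exact: (@finite_finset X). Qed.

Lemma fset_set_fset_space :
  fset_set [set: fset_space] = [fset x | x in {: X}]%fset.
Proof.
apply/fsetP => x; rewrite in_fset_set; last exact: finite_fset_space.
by rewrite mem_set//; apply/esym/imfsetP; exists x.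
Qed.

Lemma card_fset_space : #|` fset_set [set: fset_space]| = #|` X|.
Proof.
by rewrite fset_set_fset_space card_imfset//= -cardE -cardfE.
Qed.

(** This lets a Prohorov bound inside [Z] serve as a Gromov-Prohorov bound. *)
Lemma push_uniform_measure :
  push fset_isometry (uniform_measure fset_space) = fset_measure X
    :> {measure set (borel Z) -> \bar R}.
Proof.
apply: eq_measure; apply/funext => A.
rewrite fset_measureE /push/= /pushforward /uniform_measure fset_measureE.
rewrite card_fset_space [in RHS]big_seq_fsetE/= fset_set_fset_space.
by rewrite big_imfset//= big_enum.
Qed.

End FsetSpace.

(** Balls of the line are intervals, so their intersections are convex and the straight-line
    homotopy contracts them to any of their points. *)
Lemma good_metric_line (R : realType) : good_metric R^o.
Proof.
move=> s A; have [->|/set0P[x0 Ax0]] := eqVneq A set0; [by left|right].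
exists x0, (fun p => (1 - p.1) * p.2 + p.1 * x0); split => //.
- apply: continuous_subspaceT => p.
  apply: cvgD; apply: cvgM; [|exact: cvg_snd|exact: cvg_fst|exact: cvg_cst].
  by apply: cvgB; [exact: cvg_cst|exact: cvg_fst].
- move=> t x /=; rewrite /I01 /= in_itv /= => /andP[t0 t1] Ax p ps.
  have := Ax p ps; have := Ax0 p ps; rewrite /ball /= !ltr_distlC.
  move=> /andP[h1 h2] /andP[h3 h4].
  (* To be applied to the gaps separating [x] and [x0] from either end of the interval. *)
  have pos u v : 0 < u -> 0 < v -> 0 < (1 - t) * u + t * v.
    move=> u0 v0; have [tp||<-] := ltgtP 0 t; first 2 last.
    - by rewrite subr0 mul1r mul0r addr0.
    - by rewrite ltr_wpDl ?mulr_gt0// mulr_ge0 ?subr_ge0// ltW.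
    - by rewrite ltNge t0.
  have := pos (x - (p.1 - p.2)) (x0 - (p.1 - p.2)).
  have := pos ((p.1 + p.2) - x) ((p.1 + p.2) - x0).
  rewrite !subr_gt0 => /(_ h4 h2) p1 /(_ h3 h1) p2; apply/andP; split; lra.
- by move=> x Ax /=; rewrite subr0 subrr mul1r !mul0r mul1r addr0 add0r.
Qed.

(** * The two points and the clusters around them *)

Section Example.
Context (R : realType).

Let sgn (b : bool) : R^o := (-1) ^+ b.

Definition two_points : {fset R^o} := [fset sgn b | b in {: bool}]%fset.

(** The square yields distinct offsets that all stay strictly below [1 / (n + 1)]. *)
Definition shrink (n : nat) (k : 'I_n.+1) : R := k%:R / n.+1%:R ^+ 2.

(** The clusters extend towards 0, so that no point is farther than 1 from the outlier. *)
Definition cluster_point (n : nat) (t : option (bool * 'I_n.+1)) : R^o :=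
  if t is Some (b, k) then sgn b * (1 - shrink k) else 0.

Definition two_clusters (n : nat) : {fset R^o} :=
  [fset cluster_point t | t in {: option (bool * 'I_n.+1)}]%fset.

Lemma shrink_bounds n (k : 'I_n.+1) : 0 <= shrink k < n.+1%:R^-1.
Proof.
rewrite /shrink divr_ge0//= ltr_pdivrMr ?exprn_gt0// expr2 mulKf//.
by rewrite ltr_nat.
Qed.

Lemma shrink_lt1 n (k : 'I_n.+1) : shrink k < 1.
Proof.
have /andP[_ /lt_le_trans] := shrink_bounds k; apply.
by rewrite invf_le1// ler1n.
Qed.

Lemma sgn_inj : injective sgn.
Proof.
by move=> [] []; rewrite /sgn ?expr0 ?expr1// => h; exfalso; move: h; lra.
Qed.

(** Cluster points are nonzero, their absolute value determines [k], and then their sign determines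
    [b]. *)
Lemma cluster_point_inj n : injective (@cluster_point n).
Proof.
have shrink_inj : injective (@shrink n).
  move=> k l /divIf kl; apply/val_inj/eqP; rewrite -(eqr_nat R).
  by apply/eqP/kl; rewrite expf_neq0.
have neq0 b k : sgn b * (1 - @shrink n k) != 0.
  by rewrite mulf_neq0 ?signr_eq0// gt_eqF// subr_gt0 shrink_lt1.
move=> [[b k]|] [[c l]|] //= => [e||]; last 2 first.
- by move/eqP; rewrite (negPf (neq0 _ _)).
- by move/esym/eqP; rewrite (negPf (neq0 _ _)).
have kl : shrink k = shrink l.
  have := congr1 Num.norm e; rewrite /sgn !normrM !normr_sign !mul1r.
  rewrite !ger0_norm ?subr_ge0 ?(ltW (shrink_lt1 _))//.
  by move=> /addrI/oppr_inj.
have bc : sgn b = sgn c.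
  apply: (@mulIf _ (1 - shrink k)); last by rewrite e kl.
  by rewrite gt_eqF// subr_gt0 shrink_lt1.
by rewrite (sgn_inj bc) (shrink_inj _ _ kl).
Qed.

Lemma cluster_point_close n b (k : 'I_n.+1) :
  mdist (cluster_point (Some (b, k))) (sgn b) < n.+1%:R^-1.
Proof.
have /andP[s0 sn] := shrink_bounds k.
rewrite -[mdist _ _]/(`|sgn b - sgn b * (1 - shrink k)|).
by rewrite mulrBr mulr1 subKr normrM normr_sign mul1r ger0_norm.
Qed.

Lemma cluster_point_norm n (t : option (bool * 'I_n.+1)) :
  `|cluster_point t| <= 1.
Proof.
case: t => [[b k]|]; last by rewrite normr0.
have /andP[s0 _] := shrink_bounds k; have s1 := shrink_lt1 k.
by rewrite normrM normr_sign mul1r ger0_norm; lra.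
Qed.

Lemma prohorov_two_clusters n :
  (prohorov (fset_measure (two_clusters n)) (fset_measure two_points)
    <= (n.+1%:R^-1)%:E)%E.
Proof.
apply: prohorov_outlier => [||||].
- by rewrite card_bool.
- exact: cluster_point_inj.
- exact: sgn_inj.
- exact: cluster_point_close.
- rewrite lef_pV2 ?posrE// ler_nat card_bool.
  by rewrite (leq_trans _ (leqnSn _))// leq_pmull.
Qed.

Lemma zero_in_two_clusters n : (0 : R^o) \in two_clusters n.
Proof. by apply/imfsetP; exists None. Qed.

Lemma one_in_two_points : (1 : R^o) \in two_points.
Proof. by apply/imfsetP; exists false. Qed.

Lemma card_two_points : #|` two_points| = 2.
Proof. by rewrite card_imfset/= -?cardE ?card_bool//; exact: sgn_inj. Qed.

Lemma two_clusters_dist n x : x \in two_clusters n -> mdist (0 : R^o) x <= 1.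
Proof.
move=> /imfsetP[t _ ->]; rewrite -[mdist _ _]/(`|_ - 0|) subr0.
exact: cluster_point_norm.
Qed.

Lemma two_points_dist x y : x \in two_points -> y \in two_points -> y != x ->
  mdist x y = 2.
Proof.
move=> /imfsetP[b _ ->] /imfsetP[c _ ->] /=.
rewrite -[mdist _ _]/(`|_ - _|).
case: b c => -[]; rewrite /sgn ?expr0 ?expr1 ?eqxx// => _.
  by rewrite opprK ger0_norm.
by rewrite -opprD normrN ger0_norm.
Qed.

End Example.

(** * Convergence of the measures and the two discontinuities *)

Lemma cvg_inv_succ (R : realType) (u : nat -> \bar R) :
  (forall n, (0 <= u n <= (n.+1%:R^-1)%:E)%E) -> u @ \oo --> 0%E.
Proof.
move=> u_le.
apply: (@squeeze_cvge _ _ _ _ (cst 0%E) _ (fun n => (n.+1%:R^-1)%:E)).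
- exact: nearW.
- exact: cvg_cst.
- by apply: cvg_EFin; [exact: nearW|exact: cvg_harmonic].
Qed.

Theorem mainTheorem6 (R : realType) :
  (exists (Y : pmetricType R) (Yn : nat -> pmetricType R),
    [/\ finite_set [set: Y],
        forall n, finite_set [set: Yn n],
        (fun n => gromov_prohorov (uniform_measure (Yn n)) (uniform_measure Y))
          @ \oo --> 0%E &
        ~ ((fun n => d_HI (DR (Yn n)) (DR Y)) @ \oo --> 0%E)])
  /\
  (exists (Z : pmetricType R) (Y : {fset Z}) (Yn : nat -> {fset Z}),
    [/\ good_metric Z,
        Y != fset0,
        forall n, Yn n != fset0,
        (fun n => prohorov (fset_measure (Yn n)) (fset_measure Y))
          @ \oo --> 0%E &
        ~ ((fun n => d_HI (DC (Yn n)) (DC Y)) @ \oo --> 0%E)]).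
Proof.
have q0 : 0 < 3 / 4 :> R by lra.
have e0 : 0 < 1 / 4 :> R by lra.
(* d_HI < 1/4 would send the non-empty stage (1, 3/4) of the cluster spaces to
   a stage (k, r) of the two points with k > 3/4 > 1/2 and r < 1, which is
   empty *)
pose i : J R := (PosNum (@ltr01 R), PosNum q0).
split.
  pose Y := fset_space (FSetSub (one_in_two_points R)).
  pose Yn n := fset_space (FSetSub (zero_in_two_clusters R n)).
  exists Y, Yn; split.
  - exact: finite_fset_space.
  - by move=> n; exact: finite_fset_space.
  - apply: cvg_inv_succ => n; apply/andP; split.
      by apply: le_ereal_inf_tmp => _ [W [phi [psi ->]]]; exact: prohorov_ge0.
    apply: le_trans (prohorov_two_clusters R n); apply: ereal_inf_lbound.
    (* Both spaces are compared inside the line through their inclusions. *)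
    exists R^o, (fset_isometry _), (fset_isometry _).
    by rewrite !push_uniform_measure.
  - apply: (d_HI_not_cvg0 (i := i) e0) => [|n|j /= j1 j2].
      by rewrite /=; lra.
      pose x : Yn n := FSetSub (zero_in_two_clusters R n).
      apply: (@DR_inhabited R (Yn n) i x) => // [|y].
        exact: finite_fset_space.
      by apply: le_lt_trans (two_clusters_dist (valP y)) _; rewrite /=; lra.
    apply: DR_empty; first by rewrite card_fset_space card_two_points; lra.
    move=> x y yx; rewrite [leRHS](_ : _ = 2); first lra.
    exact: two_points_dist (valP x) (valP y) yx.
exists R^o, (two_points R), (two_clusters R); split.
- exact: good_metric_line.
- by apply/fset0Pn; exists 1; exact: one_in_two_points.
- by move=> n; apply/fset0Pn; exists 0; exact: zero_in_two_clusters.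
- apply: cvg_inv_succ => n; rewrite prohorov_ge0; exact: prohorov_two_clusters.
- apply: (d_HI_not_cvg0 (i := i) e0) => [|n|j /= j1 j2].
    by rewrite /=; lra.
    apply: (DC_inhabited (zero_in_two_clusters R n)) => //= y yn.
    have := two_clusters_dist yn; rewrite -[mdist _ _]/(`|_ - 0|) subr0 => y1.
    move: y1; rewrite ler_norml => /andP[y1 y2].
    (* The midpoint of 0 and [y] is within [1/2 < 3/4] of both. *)
    exists (y / 2); rewrite /ball /= !ltr_norml.
    by split; apply/andP; split; lra.
  apply: DC_empty; first by rewrite card_two_points; lra.
  (* A common point [z] of the two balls would give [2 < 2 * r] with [r < 1]. *)
  move=> x y z xY yY yx xz yz; have := two_points_dist xY yY yx.
  move: xz yz; rewrite !ballEmdist /= => xz yz xy.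
  have := metric_triangle x z y; rewrite (metric_sym z) xy; lra.
Qed.
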